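(* Let $\widehat\Sigma_f,\widehat\Sigma_g$ be the self-adjoint positive semidefinite majorization operators, and assume that there exists $\beta\in(0,1]$ such that $$\mathcal P_f\succeq\frac1{2\beta}\widehat\Sigma_f\quad\text{and}\quad \mathcal P_g\succeq\frac1{2\beta}\widehat\Sigma_g .$$ Then $\mathcal P_f\succeq0$, $\mathcal P_g\succeq0$, and for every $w_1,w_2\in\mathbb H$, with $\Delta w:=w_1-w_2$ and $\Delta\mathcal F_{sm}:=\mathcal F_{sm}(w_1)-\mathcal F_{sm}(w_2)$, both $$\Delta\mathcal F_{sm}\in\operatorname{Im}(\mathcal M)\qquad\text{and}\qquad \langle\Delta\mathcal F_{sm},\Delta w\rangle\ \ge\ \frac1{2\beta}\|\Delta\mathcal F_{sm}\|_{\mathcal M^\dagger}^2$$ hold (with this same $\beta$).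
   Context: **Setting.** $\mathbb X,\mathbb Y,\mathbb Z$ are finite-dimensional Euclidean spaces, each with an inner product $\langle\cdot,\cdot\rangle$ and induced norm $\|\cdot\|$; $\mathbb H:=\mathbb Y\times\mathbb Z\times\mathbb X$ carries the product inner product, with elements $w=(y,z,x)$. $f:\mathbb Y\to\mathbb R$ and $g:\mathbb Z\to\mathbb R$ are convex and differentiable with Lipschitz continuous gradients; $A:\mathbb Y\to\mathbb X$ is linear with adjoint $A^*$. For a self-adjoint linear operator $\Sigma$, $\|v\|_\Sigma^2:=\langle v,\Sigma v\rangle$, $\Sigma\succeq0$ means positive semidefinite, $\Sigma_1\succeq\Sigma_2$ means $\Sigma_1-\Sigma_2\succeq0$, $\operatorname{Im}(\Sigma)$ is the range, and $\Sigma^\dagger$ is the Moore--Penrose pseudoinverse. **Majorization.** $\widehat\Sigma_f$ on $\mathbb Y$ and $\widehat\Sigma_g$ on $\mathbb Z$ are self-adjoint positive semidefinite linear operators such that for all $y,y'\in\mathbb Y$, $z,z'\in\mathbb Z$: $f(y)\le f(y')+\langle\nabla f(y'),y-y'\rangle+\tfrac12\|y-y'\|_{\widehat\Sigma_f}^2$ and $g(z)\le g(z')+\langle\nabla g(z'),z-z'\rangle+\tfrac12\|z-z'\|_{\widehat\Sigma_g}^2$. Let $\sigma>0$, let $\mathcal S$ on $\mathbb Y$ and $\mathcal T$ on $\mathbb Z$ be self-adjoint linear operators (not necessarily semidefinite), and set $\mathcal P_f:=\mathcal S+\widehat\Sigma_f$, $\mathcal P_g:=\mathcal T+\widehat\Sigma_g$.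 **Operators on $\mathbb H$.** $$\mathcal F_{sm}(w)=\begin{pmatrix}\nabla f(y)\\ \nabla g(z)\\ 0\end{pmatrix},\qquad \mathcal M=\begin{pmatrix}\mathcal P_f+\sigma A^*A&0&A^*\\ 0&\mathcal P_g&0\\ A&0&\sigma^{-1}I\end{pmatrix}.$$ *)

(* Defs.v *)
From HB Require Import structures.
From mathcomp Require Import all_boot all_order all_algebra.
From mathcomp Require Import sesquilinear.
From mathcomp Require Import all_classical all_reals all_analysis.

Set Implicit Arguments.
Unset Strict Implicit.
Unset Printing Implicit Defensive.

Import Order.TTheory GRing.Theory Num.Theory.
Import numFieldNormedType.Exports.

Local Open Scope classical_set_scope.
Local Open Scope ring_scope.

(* [innerVectType]: a finite-dimensional real space with an inner product.
   [euclideanType]: moreover a normed module whose norm (hence its topology and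
   differentiability) is the one induced by the inner product. *)
HB.mixin Record Vector_hasInner (R : realType) V of Vector R V := {
  inner : {dot V for @idfun R}
}.

#[short(type="innerVectType")]
HB.structure Definition InnerVector (R : realType) :=
  { V of Vector R V & Vector_hasInner R V }.

HB.mixin Record isEuclidean (R : realType) V
    of NormedModule R V & InnerVector R V := {
  norm_inner : forall x : V, `|x| = Num.sqrt (inner x x)
}.

#[short(type="euclideanType")]
HB.structure Definition Euclidean (R : realType) :=
  { V of NormedModule R V & InnerVector R V & isEuclidean R V }.

Notation "''[' u , v ]" := (inner u%R v%R) : ring_scope.

Section InnerTheory.
Variables (R : realType) (V : innerVectType R).
Implicit Types u v w : V.

Lemma innerC u v : '[u, v] = '[v, u].
Proof. by rewrite (hermC inner u v) /= mul1r. Qed.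

Lemma inner_gt0 u : u != 0 -> 0 < '[u, u].
Proof. exact: neq0_dnorm_gt0. Qed.

Lemma inner_eq0 u : '[u, u] = 0 -> u = 0.
Proof. by move=> u0; apply/eqP/negPn/negP => /inner_gt0; rewrite u0 ltxx. Qed.

Lemma inner_ext u v : (forall w, '[u, w] = '[v, w]) -> u = v.
Proof.
move=> uv; apply/subr0_eq/inner_eq0.
by rewrite linearBl /= uv subrr.
Qed.

Lemma riesz (l : {linear V -> R^o}) : exists v, forall h, l h = '[v, h].
Proof.
pose phi (v : V) : 'Hom(V, R^o) := linfun (inner v : V -> R^o).
have phiE v h : phi v h = '[v, h] by rewrite lfunE.
have phi_lin : linear phi.
  by move=> a u v; apply/lfunP => h; rewrite add_lfunE scale_lfunE !phiE linearPl.
pose phiL := GRing.isLinear.Build _ _ _ _ phi phi_lin.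
pose Phi : {linear V -> 'Hom(V, R^o)} := HB.pack phi phiL.
pose F := linfun Phi.
have kerF : lker F == 0%VS.
  apply/lker0P => u v; rewrite !lfunE /= => uv.
  by apply: inner_ext => w; rewrite -!phiE uv.
have imF : limg F = fullv.
  apply/eqP; rewrite eqEdim subvf /=.
  have -> : \dim (limg F) = \dim {:V}.
    by apply: limg_dim_eq; rewrite (eqP kerF) capv0.
  by rewrite !dimvf [X in (X <= _)%N]muln1.
have : linfun l \in limg F by rewrite imF memvf.
move=> /memv_imgP[v _ lv]; exists v => h.
by rewrite -(lfunE l) lv lfunE phiE.
Qed.

End InnerTheory.

(* Products carry the sum inner product as an [innerVectType] only: the library
   equips [U * V] with the sup norm, so it is not a [euclideanType]. *)
Section ProdInner.
Variables (R : realType) (U V : innerVectType R).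

Definition prod_inner (p q : U * V) : R := '[p.1, q.1] + '[p.2, q.2].

Let prod_inner_linearl q :
  linear_for ( *%R ) (prod_inner ^~ q : U * V -> R).
Proof.
move=> a p p'; rewrite /prod_inner /= !linearPl /=.
by rewrite mulrDr addrACA.
Qed.

Let prod_innerC p q : prod_inner p q = prod_inner q p.
Proof. by congr (_ + _); exact: innerC. Qed.

Let prod_inner_linearr p :
  linear_for (@idfun R \; *%R) (prod_inner p : U * V -> R).
Proof. by move=> a q q'; rewrite ![prod_inner p _]prod_innerC prod_inner_linearl. Qed.

HB.instance Definition _ := bilinear_isBilinear.Build R (U * V)%type (U * V)%type R
  ( *%R ) (@idfun R \; *%R) prod_inner (conj prod_inner_linearl prod_inner_linearr).

Let prod_inner_herm p q :
  prod_inner p q = (-1) ^+ false * @idfun R (prod_inner q p).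
Proof. by rewrite mul1r prod_innerC. Qed.

HB.instance Definition _ :=
  isHermitianSesquilinear.Build R (U * V)%type false (@idfun R) prod_inner prod_inner_herm.

Let prod_inner_gt0 p : p != 0 -> 0 < prod_inner p p.
Proof.
have ge0 (W : innerVectType R) (x : W) : 0 <= '[x, x].
  by have [->|/inner_gt0/ltW//] := eqVneq x 0; rewrite linear0l.
case: p => u v; rewrite /prod_inner -pair_eqE negb_and => /orP[] /inner_gt0 /= h.
  exact: ltr_wpDr.
exact: ltr_wpDl.
Qed.

HB.instance Definition _ := isDotProduct.Build R (U * V)%type prod_inner prod_inner_gt0.

HB.instance Definition _ := Vector_hasInner.Build R (U * V)%type prod_inner.

End ProdInner.

Section Operators.
Variable R : realType.
Implicit Types U V W : innerVectType R.

Definition adjoint U V (A : 'Hom(U, V)) : 'Hom(V, U) :=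
  xget 0 [set B : 'Hom(V, U) | forall u v, '[A u, v] = '[u, B v]].

Lemma adjointP U V (A : 'Hom(U, V)) u v : '[A u, v] = '[u, adjoint A v].
Proof.
rewrite /adjoint; case: xgetP => [B _ //|noB]; exfalso.
have ex v' : exists w, forall u', '[A u', v'] = '[u', w].
  have lin : linear (fun u' => '[v', A u'] : R^o).
    by move=> a x y; rewrite !linearP.
  pose linM := GRing.isLinear.Build _ _ _ _ (fun u' => '[v', A u'] : R^o) lin.
  pose l : {linear U -> R^o} := HB.pack (fun u' => '[v', A u'] : R^o) linM.
  by have [w lw] := riesz l; exists w => u'; rewrite innerC [RHS]innerC -lw.
have [B BP] := choice ex.
have B_lin : linear B.
  move=> a x y; apply: inner_ext => z.
  by rewrite linearPl innerC -BP linearPr /= !BP ![in RHS](innerC _ z).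
pose BM := GRing.isLinear.Build _ _ _ _ B B_lin.
pose BL : {linear V -> U} := HB.pack B BM.
by apply: (noB (linfun BL)) => u' v'; rewrite lfunE /= BP.
Qed.

Definition selfadjoint V (S : 'End(V)) := forall u v, '[S u, v] = '[u, S v].

Definition sqnorm V (S : 'End(V)) (v : V) : R := '[v, S v].

Definition psd V (S : 'End(V)) := selfadjoint S /\ forall v, 0 <= sqnorm S v.

Definition loewner_ge V (S1 S2 : 'End(V)) := psd (S1 - S2).

Definition penrose U V (M : 'Hom(U, V)) (G : 'Hom(V, U)) :=
  [/\ (M \o G \o M)%VF = M, (G \o M \o G)%VF = G,
      selfadjoint (M \o G)%VF & selfadjoint (G \o M)%VF].

(* Existence is [mp_inverseP] and uniqueness is [penrose_unique] below. *)
Definition mp_inverse U V (M : 'Hom(U, V)) : 'Hom(V, U) := xget 0 (penrose M).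

Lemma penrose_unique U V (M : 'Hom(U, V)) G H :
  penrose M G -> penrose M H -> G = H.
Proof.
move=> [MGM GMG saMG saGM] [MHM HMH saMH saHM].
have E (K L : 'Hom(U, V)) : K = L -> forall x, K x = L x by move=> ->.
have {}MGM x : M (G (M x)) = M x by rewrite -[in RHS]MGM !comp_lfunE.
have {}MHM x : M (H (M x)) = M x by rewrite -[in RHS]MHM !comp_lfunE.
have {}GMG x : G (M (G x)) = G x by rewrite -[in RHS]GMG !comp_lfunE.
have {}HMH x : H (M (H x)) = H x by rewrite -[in RHS]HMH !comp_lfunE.
have {}saMG x y : '[M (G x), y] = '[x, M (G y)].
  by have := saMG x y; rewrite !comp_lfunE.
have {}saMH x y : '[M (H x), y] = '[x, M (H y)].
  by have := saMH x y; rewrite !comp_lfunE.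
have {}saGM x y : '[G (M x), y] = '[x, G (M y)].
  by have := saGM x y; rewrite !comp_lfunE.
have {}saHM x y : '[H (M x), y] = '[x, H (M y)].
  by have := saHM x y; rewrite !comp_lfunE.
have MGH x : M (G x) = M (H x).
  apply: inner_ext => y.
  by rewrite -[M (G x)]MHM saMH saMG MGM -saMH.
have GHM x : G (M x) = H (M x).
  apply: inner_ext => y.
  by rewrite -[in LHS]MHM saGM saHM MGM -saHM.
by apply/lfunP => x; rewrite -GMG MGH GHM HMH.
Qed.

Lemma adjointK U V (A : 'Hom(U, V)) : adjoint (adjoint A) = A.
Proof.
apply/lfunP => u; apply: inner_ext => v.
by rewrite innerC -adjointP innerC -adjointP.
Qed.

Lemma limg_adjoint U V (A : 'Hom(U, V)) :
  limg (adjoint A \o A)%VF = limg (adjoint A).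
Proof.
have sub W W' (B : 'Hom(W, W')) :
    (limg (adjoint B \o B)%VF <= limg (adjoint B))%VS.
  by rewrite limg_comp limgS ?subvf.
have rk W W' (B : 'Hom(W, W')) : \dim (limg (adjoint B \o B)%VF) = \dim (limg B).
  have kerE : lker (adjoint B \o B)%VF = lker B.
    apply/vspaceP => x; rewrite !memv_ker comp_lfunE.
    apply/eqP/eqP => [BBx|->]; last by rewrite linear0.
    by apply: inner_eq0; rewrite adjointP BBx linear0r.
  apply: (@addnI (\dim (fullv :&: lker B))).
  by rewrite -[in LHS]kerE !limg_ker_dim.
apply/eqP; rewrite eqEdim sub rk /= -(rk _ _ (adjoint A)).
by apply: leq_trans (dimvS (sub _ _ _)) _; rewrite adjointK.
Qed.

Lemma range_projector U V (A : 'Hom(U, V)) : exists P : 'End(V),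
  [/\ selfadjoint P, forall x, P x \in limg A, forall u, P (A u) = A u
    & forall x, adjoint A x = 0 -> P x = 0].
Proof.
pose P : 'End(V) := (A \o (adjoint A \o A)^-1 \o adjoint A)%VF.
have PA x : adjoint A (P x) = adjoint A x.
  have /limg_lfunVK : adjoint A x \in limg (adjoint A \o A)%VF.
    by rewrite limg_adjoint memv_img ?memvf.
  by rewrite /P !comp_lfunE.
have Pim x : exists u, P x = A u by rewrite /P !comp_lfunE; eexists.
exists P; split.
- have PP x y : '[P x, y] = '[P x, P y].
    by have [u ->] := Pim x; rewrite !adjointP PA.
  by move=> x y; rewrite PP innerC -PP innerC.
- by move=> x; have [u ->] := Pim x; rewrite memv_img ?memvf.
- move=> u; have [u' Pu] := Pim (A u); apply/subr0_eq/inner_eq0.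
  rewrite {1}Pu -linearB adjointP linearB /= PA subrr.
  by rewrite linear0r.
- by move=> x x0; rewrite /P !comp_lfunE x0 !linear0.
Qed.

Lemma mp_inverseP U V (M : 'Hom(U, V)) : penrose M (mp_inverse M).
Proof.
rewrite /mp_inverse; case: xgetP => [G _ //|noG]; exfalso.
have [P [saP Pim PM _]] := range_projector M.
have [Q [saQ Qim QM Q0]] := range_projector (adjoint M).
rewrite adjointK in Q0.
have MQ x : M (Q x) = M x.
  apply: inner_ext => y.
  by rewrite adjointP saQ QM -adjointP.
pose G := (Q \o M^-1 \o P)%VF.
have MG x : M (G x) = P x by rewrite /G !comp_lfunE MQ limg_lfunVK.
have GM x : G (M x) = Q x.
  rewrite /G !comp_lfunE PM; apply/subr0_eq; rewrite -linearB.
  by apply: Q0; rewrite linearB /= limg_lfunVK ?memv_img ?memvf // subrr.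
have Gim x : G x \in limg (adjoint M) by rewrite /G !comp_lfunE Qim.
move: G MG GM Gim => G MG GM Gim.
apply: (noG G); split.
- by apply/lfunP => x; rewrite !comp_lfunE MG PM.
- apply/lfunP => x; rewrite !comp_lfunE GM.
  by have /memv_imgP[y _ ->] := Gim x; exact: QM.
- by move=> x y; rewrite !comp_lfunE !MG.
- by move=> x y; rewrite !comp_lfunE !GM.
Qed.

End Operators.

Section Smooth.
Variables (R : realType) (E : euclideanType R).

(* [gradient f x] is meaningful only where [f] is differentiable: elsewhere
   ['d f x] is an unspecified linear map. *)
Definition gradient (f : E -> R) (x : E) : E :=
  get [set v : E | forall h : E, 'd f x h = '[v, h]].

Lemma gradientP (f : E -> R) (x h : E) : 'd f x h = '[gradient f x, h].
Proof.
rewrite /gradient; case: xgetP => [v _ //|nov]; exfalso.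
by have [v lv] := @riesz R E ('d f x); apply: (nov v).
Qed.

Definition majorization (f : E -> R) (S : 'End(E)) := forall x x' : E,
  f x <= f x' + '[gradient f x', x - x'] + 2^-1 * sqnorm S (x - x').

End Smooth.

Section BlockOperators.
Variables (R : realType) (Y Z X : euclideanType R).

(* A triple (y, z, x) is [w : Y * Z * X] with y = w.1.1, z = w.1.2, x = w.2;
   its inner product is the sum given by [prod_inner]. *)

Definition smooth_op (f : Y -> R) (g : Z -> R) (w : Y * Z * X) : Y * Z * X :=
  (gradient f w.1.1, gradient g w.1.2, 0).

Section Precond.
Variables (Pf : 'End(Y)) (Pg : 'End(Z)) (A : 'Hom(Y, X)) (sigma : R).

Definition precond_fun (w : Y * Z * X) : Y * Z * X :=
  ((Pf + sigma *: (adjoint A \o A)%VF) w.1.1 + adjoint A w.2,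
   Pg w.1.2,
   A w.1.1 + sigma^-1 *: w.2).

Fact precond_fun_linear : linear precond_fun.
Proof.
move=> a w w'; rewrite /precond_fun /= !linearP /=.
have addE (U V : zmodType) (u u' : U) (v v' : V) :
  (u, v) + (u', v') = (u + u', v + v') by [].
have scaleE (U V : lmodType R) (b : R) (u : U) (v : V) :
  b *: (u, v) = (b *: u, b *: v) by [].
rewrite !scaleE !addE !scalerDr !scalerA; congr (_, _, _).
  by rewrite addrACA.
by rewrite mulrC addrACA.
Qed.

HB.instance Definition _ :=
  GRing.isLinear.Build R _ _ _ precond_fun precond_fun_linear.

Definition precond_op : 'End((Y * Z * X)%type) := linfun precond_fun.

Lemma precond_opE w : precond_op w = precond_fun w.
Proof. exact: lfunE. Qed.

End Precond.
End BlockOperators.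

(* Main.v *)
(* Convexity and majorization give, for every test direction [h],
   [<dF, dw> >= 2 <dF, h> - |h|^2_Sigma >= 2 <dF, h> - 2 beta |h|^2_M],
   the second step because [M] is [diag(P_f, P_g, 0)] plus a positive
   semidefinite term.  Boundedness of the right-hand side in [h] forces [dF]
   into [Im M], and [h = (2 beta)^-1 M^+ dF] gives the stated bound. *)
Require Import Defs.
From HB Require Import structures.
From mathcomp Require Import all_boot all_order all_algebra.
From mathcomp Require Import sesquilinear.
From mathcomp Require Import all_classical all_reals all_analysis.
From mathcomp Require Import ring lra.

Import Order.TTheory GRing.Theory Num.Theory.
Import numFieldNormedType.Exports.

Local Open Scope classical_set_scope.
Local Open Scope ring_scope.

Section InnerLemmas.
Context {R : realType} {V : innerVectType R}.
Implicit Types (u v w : V) (S T : 'End(V)).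

(* Restating the generic linearity lemmas for [inner] fixes the head symbol: with
   them, iterated rewriting also fires on products in [R], which are linear too. *)
Lemma inner0l u : '[0, u] = 0.
Proof. exact: linear0l. Qed.

Lemma innerDl u v w : '[u + v, w] = '[u, w] + '[v, w].
Proof. exact: linearDl. Qed.

Lemma innerDr u v w : '[u, v + w] = '[u, v] + '[u, w].
Proof. exact: linearDr. Qed.

Lemma innerNl u v : '[- u, v] = - '[u, v].
Proof. exact: linearNl. Qed.

Lemma innerNr u v : '[u, - v] = - '[u, v].
Proof. exact: linearNr. Qed.

Lemma innerZl (a : R) u v : '[a *: u, v] = a * '[u, v].
Proof. exact: linearZl_LR. Qed.

Lemma innerZr (a : R) u v : '[u, a *: v] = a * '[u, v].
Proof. exact: linearZr. Qed.

Lemma inner_ge0 u : 0 <= '[u, u].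
Proof. by have [->|/inner_gt0/ltW//] := eqVneq u 0; rewrite linear0l. Qed.

Lemma selfadjointD S T : selfadjoint S -> selfadjoint T -> selfadjoint (S + T).
Proof.
by move=> sS sT u v; rewrite !add_lfunE innerDl innerDr sS sT.
Qed.

Lemma sqnormB S T v : sqnorm (S - T) v = sqnorm S v - sqnorm T v.
Proof. by rewrite /sqnorm add_lfunE opp_lfunE innerDr innerNr. Qed.

Lemma sqnormZ (a : R) S v : sqnorm (a *: S) v = a * sqnorm S v.
Proof. by rewrite /sqnorm scale_lfunE innerZr. Qed.

Lemma sqnormZv (a : R) S v : sqnorm S (a *: v) = a ^+ 2 * sqnorm S v.
Proof. by rewrite /sqnorm linearZ /= innerZr innerZl mulrA -expr2. Qed.

Lemma loewner_scale_le (k : R) P S v : 0 < k ->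
  loewner_ge P (k^-1 *: S) -> sqnorm S v <= k * sqnorm P v.
Proof.
move=> k0 [_ /(_ v)]; rewrite sqnormB sqnormZ subr_ge0.
by rewrite ler_pdivrMl.
Qed.

Lemma mp_inverseK S v : v \in limg S -> S (mp_inverse S v) = v.
Proof.
move=> /memv_imgP[u _ ->]; have [SGS _ _ _] := mp_inverseP S.
by rewrite -[in RHS]SGS !comp_lfunE.
Qed.

(* The left-hand side [2 <d, h> - k <h, S h>] is unbounded in [h] unless [d] is
   in the range of [S], and then equals [k^-1 <d, S^+ d>] at [h = k^-1 S^+ d]. *)
Lemma conjugate_quadratic_bound S (d : V) (k c : R) : selfadjoint S -> 0 < k ->
    (forall h, 2 * '[d, h] - k * sqnorm S h <= c) ->
  d \in limg S /\ k^-1 * sqnorm (mp_inverse S) d <= c.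
Proof.
move=> saS k0 bnd.
have dS : d \in limg S.
  have [Q [saQ Qim QS _]] := range_projector S.
  (* [Q] is the orthogonal projector onto the range of [S], so [e] is the part of [d] orthogonal to
     that range; self-adjointness puts it in the kernel of [S]. *)
  pose e := d - Q d.
  have Se : S e = 0.
    apply: inner_ext => y; rewrite saS inner0l innerDl innerNl saQ QS.
    by rewrite subrr.
  have de : '[d, e] = '[e, e].
    have [u Qu] : exists u, Q d = S u by have /memv_imgP[u _ ->] := Qim d; exists u.
    by rewrite [RHS]innerDl innerNl Qu saS Se linear0r subr0.
  suff e0 : e = 0 by rewrite (subr0_eq e0).
  apply/eqP/negPn/negP => /inner_gt0 ee0.
  (* Along [e] the quadratic term vanishes; this multiple brings the linear term to [c + 1], above
     the bound [c]. *)
  have := bnd (((c + 1) / (2 * '[e, e])) *: e).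
  rewrite sqnormZv innerZr de /sqnorm Se linear0r !mulr0 subr0.
  have -> : 2 * ((c + 1) / (2 * '[e, e]) * '[e, e]) = c + 1.
    by field; rewrite (gt_eqF ee0).
  by rewrite gerDl ler10.
split=> //.
have := bnd (k^-1 *: mp_inverse S d).
rewrite sqnormZv innerZr.
have -> : sqnorm S (mp_inverse S d) = sqnorm (mp_inverse S) d.
  by rewrite /sqnorm mp_inverseK // innerC.
rewrite -/(sqnorm (mp_inverse S) d).
set q := sqnorm _ _.
suff -> : 2 * (k^-1 * q) - k * (k^-1 ^+ 2 * q) = k^-1 * q by [].
by field; rewrite gt_eqF.
Qed.

End InnerLemmas.

Section ConvexSmooth.
Context {R : realType} {E : euclideanType R}.
Variables (f : E -> R) (S : 'End(E)).
Hypotheses (f_convex : @convex_function R E setT f)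
  (f_diff : forall x, differentiable f x) (f_maj : majorization f S).

(** Convexity bounds each difference quotient from [x] towards [y], with step in (0, 1], by
    [f y - f x]; their limit from the right is the directional derivative. *)
Lemma convex_gradient_le (x y : E) : f x + '[gradient f x, y - x] <= f y.
Proof.
rewrite addrC -lerBrDr -gradientP -deriveE //.
have cv : h^-1 *: ((f \o shift x) (h *: (y - x)) - f x) @[h --> 0^'] -->
    'D_(y - x) f x by exact: diff_derivable.
have cvr := cvg_dnbhs_at_right cv.
apply: (cvgr_to_le cvr); near=> t.
have t0 : 0 < t by near: t; exact: nbhs_right_gt.
have t1 : t <= 1 by near: t; exact: nbhs_right_le.
rewrite /= -[_ *: _]/(_ * _) ler_pdivrMl // lerBlDr.
have := f_convex (Itv01 (ltW t0) t1) y x (mem_set I) (mem_set I).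
rewrite convRE /=.
(* The weight [t] falls on the first point, [y]. *)
suff -> : conv (Itv01 (ltW t0) t1) (y : convex_lmodType E) x =
      t *: (y - x) + x.
  by move/le_trans; apply; rewrite /unstable.onem; lra.
rewrite /conv /= /unstable.onem scalerBl scale1r scalerBr.
by rewrite addrCA addrC.
Unshelve. all: by end_near. Qed.

(* [f (x - h)] lies above the tangent at [x'] and below the majorant at [x];
   symmetrically for [f (x' + h)].  Adding the four bounds cancels all values
   of [f]. *)
Lemma gradient_cocoercive (x x' h : E) :
  2 * '[gradient f x - gradient f x', h] - sqnorm S h <=
  '[gradient f x - gradient f x', x - x'].
Proof.
have m1 := f_maj (x - h) x.
have m2 := f_maj (x' + h) x'.
have c1 := convex_gradient_le x' (x - h).
have c2 := convex_gradient_le x (x' + h).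
move: m1 m2 c1 c2.
have -> : x - h - x = - h by rewrite addrAC subrr add0r.
have -> : x' + h - x' = h by rewrite addrAC subrr add0r.
have -> : sqnorm S (- h) = sqnorm S h.
  by rewrite -scaleN1r sqnormZv sqrrN expr1n mul1r.
(* Abstracting the gradients keeps [innerDr] from unfolding them. *)
move: (sqnorm S h) (gradient f x) (gradient f x') => q G G'.
rewrite !(innerDl, innerDr, innerNl, innerNr).
lra.
Qed.

End ConvexSmooth.

Lemma prod_innerE (R : realType) (U V : innerVectType R) (p q : U * V) :
  '[p, q] = '[p.1, q.1] + '[p.2, q.2].
Proof. by []. Qed.

Section Precond.
Context {R : realType} {Y Z X : euclideanType R}.
Variables (Pf : 'End(Y)) (Pg : 'End(Z)) (A : 'Hom(Y, X)) (sigma : R).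

Lemma precond_selfadjoint :
  selfadjoint Pf -> selfadjoint Pg -> selfadjoint (precond_op Pf Pg A sigma).
Proof.
move=> sPf sPg u v; rewrite !precond_opE !prod_innerE /=.
rewrite !(add_lfunE, scale_lfunE, comp_lfunE).
rewrite !(innerDl, innerDr, innerZl, innerZr) sPf sPg.
have adjl a b : '[adjoint A a, b] = '[a, A b] by rewrite adjointP adjointK.
rewrite !adjl -!adjointP.
ring.
Qed.

(** Completing the square: the terms in [A] and [sigma^-1] combine into one nonnegative term, so the
    operator dominates the block diagonal of [Pf], [Pg] and 0. *)
Lemma sqnorm_precond (w : Y * Z * X) : 0 < sigma ->
  sqnorm (precond_op Pf Pg A sigma) w =
  sqnorm Pf w.1.1 + sqnorm Pg w.1.2 +
  sigma^-1 * '[sigma *: A w.1.1 + w.2, sigma *: A w.1.1 + w.2].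
Proof.
move=> s0.
have sq (a b : X) : '[sigma *: a + b, sigma *: a + b] =
    sigma ^+ 2 * '[a, a] + 2 * sigma * '[a, b] + '[b, b].
  rewrite !(innerDl, innerDr, innerZl, innerZr) (innerC b a).
  ring.
rewrite sq /sqnorm precond_opE !prod_innerE /=.
rewrite !(add_lfunE, scale_lfunE, comp_lfunE).
rewrite !(innerDl, innerDr, innerZl, innerZr) -!adjointP.
rewrite (innerC w.2 (A _)).
by field; rewrite gt_eqF.
Qed.

End Precond.

Theorem proposition3p4 (R : realType) (Y Z X : euclideanType R)
    (f : Y -> R) (g : Z -> R) (A : 'Hom(Y, X))
    (Sigmaf calS : 'End(Y)) (Sigmag calT : 'End(Z)) (sigma beta : R)
    (f_convex : @convex_function R Y setT f)
    (g_convex : @convex_function R Z setT g)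
    (f_diff : forall y : Y, differentiable f y)
    (g_diff : forall z : Z, differentiable g z)
    (gradf_lip : exists L : R, L.-lipschitz (gradient f))
    (gradg_lip : exists L : R, L.-lipschitz (gradient g))
    (Sigmaf_psd : psd Sigmaf) (Sigmag_psd : psd Sigmag)
    (f_maj : majorization f Sigmaf) (g_maj : majorization g Sigmag)
    (sigma_gt0 : 0 < sigma)
    (S_sa : selfadjoint calS) (T_sa : selfadjoint calT)
    (beta_gt0 : 0 < beta) (beta_le1 : beta <= 1) :
  let Pf := calS + Sigmaf in
  let Pg := calT + Sigmag in
  let M := precond_op Pf Pg A sigma in
  loewner_ge Pf ((2 * beta)^-1 *: Sigmaf) ->
  loewner_ge Pg ((2 * beta)^-1 *: Sigmag) ->
  [/\ psd Pf, psd Pg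
    & forall w1 w2 : Y * Z * X,
        let dw := w1 - w2 in
        let dF := smooth_op f g w1 - smooth_op f g w2 in
        dF \in limg M /\
        '[dF, dw] >= (2 * beta)^-1 * sqnorm (mp_inverse M) dF].
Proof.
move=> Pf Pg M Pf_ge Pg_ge.
have k0 : 0 < 2 * beta by rewrite mulr_gt0.
have psdP (E : innerVectType R) (P S : 'End(E)) : psd S -> selfadjoint P ->
    loewner_ge P ((2 * beta)^-1 *: S) -> psd P.
  move=> [_ S0] sP /(loewner_scale_le _ _ _ _ k0) PS; split=> // v.
  by rewrite -(pmulr_rge0 _ k0) (le_trans (S0 v)) // PS.
have psdPf : psd Pf.
  by apply: psdP Pf_ge => //; apply: selfadjointD => //; case: Sigmaf_psd.
have psdPg : psd Pg.
  by apply: psdP Pg_ge => //; apply: selfadjointD => //; case: Sigmag_psd.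
split=> // w1 w2 dw dF.
(* Used with [k = 2 * beta] and [c = '[dF, dw]]. *)
apply: conjugate_quadratic_bound => // [|h].
  by apply: precond_selfadjoint; [case: psdPf|case: psdPg].
have := gradient_cocoercive _ _ f_convex f_diff f_maj w1.1.1 w2.1.1 h.1.1.
have := gradient_cocoercive _ _ g_convex g_diff g_maj w1.1.2 w2.1.2 h.1.2.
have := loewner_scale_le _ _ _ h.1.1 k0 Pf_ge.
have := loewner_scale_le _ _ _ h.1.2 k0 Pg_ge.
(* The last component of [smooth_op] is constantly 0, so [h.2] enters only through the square [r]
   below. *)
have dF_x : dF.2 = 0 by exact: subrr.
rewrite sqnorm_precond // !prod_innerE dF_x !inner0l !addr0 !mulrDr /=.
set r := (sigma^-1 * _).
have r0 : 0 <= r by rewrite mulr_ge0 ?inner_ge0 // invr_ge0 ltW.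
(* The bound is the sum of the two cocoercivity inequalities, the two Loewner bounds and
   [0 <= 2 * beta * r]. *)
have := mulr_ge0 (ltW k0) r0; rewrite -/Pf -/Pg; lra.
Qed.
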